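(* Let the entries of the matrix (the pre-array) $A\in\mathbb{R}^{(s+k)\times(s+l)}$ be known differentiable functions of a parameter $\theta$. Consider the equation of the form $QA=L$ with the following partitioning: $$Q\left[\begin{array}{c|c}A_{11}&A_{12}\\ A_{21}&A_{22}\end{array}\right]=\left[\begin{array}{c|c}0&L_{12}\\ L_{21}&L_{22}\end{array}\right],$$ where, in both partitioned matrices, the block rows have sizes $k$ and $s$ (from top to bottom) and the block columns have sizes $s$ and $l$ (from left to right), $Q\in\mathbb{R}^{(s+k)\times(s+k)}$ is an orthogonal matrix that lower-triangularizes the first (block) column of the matrix $A$ on the left-hand side, and $L_{21}\in\mathbb{R}^{s\times s}$ is lower triangular. Introduce the notation $$Q\left[\begin{array}{c|c}(A_{11})'_\theta&(A_{12})'_\theta\\ (A_{21})'_\theta&(A_{22})'_\theta\end{array}\right]=\left[\begin{array}{c|c}X&N\\ Y&V\end{array}\right],$$ with the same block sizes (block rows $k$, $s$; block columns $s$, $l$). Then, given the derivative $A'_\theta$ of the pre-array, the following formulas calculate the corresponding derivatives of the blocks of the post-array $L$: $$(L_{21})'_\theta=\bigl(\bar{\mathcal U}^T+\mathcal D+\bar{\mathcal L}\bigr)L_{21},$$ $$(L_{22})'_\theta=\bigl[\bar{\mathcal U}^T-\bar{\mathcal U}\bigr]L_{22}+L_{21}^{-T}X^TL_{12}+V,$$ where $\bar{\mathcal L}$, $\mathcal D$ and $\bar{\mathcal U}$ are respectively the strictly lower triangular, diagonal and strictly upper triangular parts of the matrix product $YL_{21}^{-1}$.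
   Context: $(\cdot)'_\theta$ denotes the (entrywise) derivative with respect to $\theta$, a superscript $T$ denotes the transpose, and $M^{-T}=(M^{-1})^T$. The matrix $A$ is called the pre-array and the matrix $L=QA$ the post-array. The strictly lower triangular, diagonal and strictly upper triangular parts of a square matrix $M$ are the matrices $\bar{\mathcal L}$, $\mathcal D$, $\bar{\mathcal U}$ of these respective types with $M=\bar{\mathcal L}+\mathcal D+\bar{\mathcal U}$. *)

(* Defs.v *)
From mathcomp Require Export all_boot all_order all_algebra.
From mathcomp Require Export all_classical all_reals all_analysis.
Export Order.TTheory GRing.Theory Num.Theory.
Export numFieldNormedType.Exports.

Set Implicit Arguments.
Unset Strict Implicit.
Unset Printing Implicit Defensive.

Local Open Scope ring_scope.

Definition orthogonal_mx (R : comPzRingType) (n : nat) (Q : 'M[R]_n) : Prop :=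
  Q *m Q^T = 1%:M /\ Q^T *m Q = 1%:M.

Definition strict_lower_part (R : pzRingType) (n : nat) (M : 'M[R]_n) : 'M[R]_n :=
  \matrix_(i, j) (if (j < i)%N then M i j else 0).

Definition diag_part (R : pzRingType) (n : nat) (M : 'M[R]_n) : 'M[R]_n :=
  \matrix_(i, j) (if i == j then M i j else 0).

Definition strict_upper_part (R : pzRingType) (n : nat) (M : 'M[R]_n) : 'M[R]_n :=
  \matrix_(i, j) (if (i < j)%N then M i j else 0).

Lemma triangular_parts_sum (R : pzRingType) (n : nat) (M : 'M[R]_n) :
  M = strict_lower_part M + diag_part M + strict_upper_part M.
Proof.
apply/matrixP => i j; rewrite !mxE.
by rewrite -val_eqE /=; case: ltngtP; rewrite ?addr0 ?add0r.
Qed.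

(* Main.v *)
(* With B = QA, orthogonality gives A^T A = B^T B, whose first block row is
   (L21^T L21, L21^T L22): the unknown Q drops out, and L21 is a triangular
   factor of a differentiable matrix G.  Set D = L21(t) - L21(theta).  Then
   L21(t)^-T (G(t) - G(theta)) L21(theta)^-1 is the sum of the lower triangular
   D L21(theta)^-1 and the upper triangular (D L21(t)^-1)^T.  Continuity of L21
   thus suffices to make the difference quotient of L21 converge, with no
   differentiability of Q assumed, and the limit is read off entrywise.
   L22 is then obtained by solving L21^T L22 = (A^T A)_12. *)
Require Import Defs.

Set Implicit Arguments.
Unset Strict Implicit.
Unset Printing Implicit Defensive.

Local Open Scope classical_set_scope.
Local Open Scope ring_scope.

(** * Lower triangular matrices *)

(** A nonzero summand [A i k * B k j] forces [j <= k <= i], so on or above the diagonal only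
    [k = i = j] can survive. *)
Lemma trigmx_mulmxE (R : pzRingType) n (A B : 'M[R]_n) (i j : 'I_n) :
  is_trig_mx A -> is_trig_mx B -> (i <= j)%N ->
  (A *m B) i j = if i == j then A i i * B i i else 0.
Proof.
move=> /is_trig_mxP tA /is_trig_mxP tB ij; rewrite mxE.
case: eqP => [<-|/eqP ne].
  rewrite (bigD1 i) //= big1 ?addr0 // => k; rewrite -val_eqE /=.
  by case: ltngtP => // [/tB ->|/tA ->] _; rewrite ?mulr0 ?mul0r.
have {ne}ij : (i < j)%N by rewrite ltn_neqAle ij andbT.
rewrite big1 // => k _; have [/tA ->|ki] := ltnP i k; first by rewrite mul0r.
by rewrite tB ?mulr0 // (leq_ltn_trans ki).
Qed.

Lemma trigmx_mulmx (R : pzRingType) n (A B : 'M[R]_n) :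
  is_trig_mx A -> is_trig_mx B -> is_trig_mx (A *m B).
Proof.
move=> tA tB; apply/is_trig_mxP => i j ij.
by rewrite trigmx_mulmxE ?(ltnW ij) // -val_eqE (ltn_eqF ij).
Qed.

Lemma trigmx_unit_diag (F : fieldType) n (A : 'M[F]_n) i :
  is_trig_mx A -> A \in unitmx -> A i i != 0.
Proof.
by move=> tA; rewrite unitmxE unitfE det_trig // prodf_seq_neq0 =>
  /allP/(_ i); rewrite mem_index_enum; exact.
Qed.

(** Strong induction on the row [i]: entry [(i, j)] of [A *m invmx A = 1] with [i < j] loses its
    terms [k < i] by induction and [k > i] by triangularity. What is left is
    [A i i * invmx A i j = 0], with a nonzero pivot. *)
Lemma trigmx_invmx (F : fieldType) n (A : 'M[F]_n) :
  A \in unitmx -> is_trig_mx A -> is_trig_mx (invmx A).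
Proof.
move=> uA tA; apply/is_trig_mxP => i j.
have [m] := ubnP (i : nat); elim: m => // m IH in i * => im ij.
apply: (mulfI (trigmx_unit_diag i tA uA)); rewrite mulr0.
have /matrixP/(_ i j) := mulmxV uA.
rewrite !mxE -val_eqE (ltn_eqF ij) (bigD1 i) //= big1 ?addr0 // => k.
rewrite -val_eqE /=; case: ltngtP => // ki _; last first.
  by move/is_trig_mxP: tA => ->; rewrite ?mul0r.
by rewrite IH ?mulr0 ?(ltn_trans ki ij) // (leq_trans ki).
Qed.

(** * Limits of matrix-valued functions *)

Section cvg_mx.
Context {R : realType} {T : Type} {F : set_system T} {FF : Filter F}.

Lemma cvg_mxP m n (f : T -> 'M[R]_(m, n)) (M : 'M[R]_(m, n)) :
  f x @[x --> F] --> M <-> forall i j, f x i j @[x --> F] --> M i j.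
Proof.
split=> [fM i j|fM].
  exact: (cvg_comp f (fun N : 'M[R]_(m, n) => N i j) fM
    (@coord_continuous _ _ _ i j M)).
apply/cvgrPdist_le => /= e e0; near=> x.
rewrite /Num.Def.normr/= mx_normrE (bigmax_le _ (ltW e0))//= => i _.
rewrite !mxE/=; move: i; near: x; apply: filter_forall => /= i.
exact: ((cvgrPdist_le _ _).1 (fM i.1 i.2)).
Unshelve. all: by end_near. Qed.

Lemma cvg_sumr (I : Type) (r : seq I) (f : I -> T -> R) (l : I -> R) :
  (forall i, f i x @[x --> F] --> l i) ->
  \sum_(i <- r) f i x @[x --> F] --> \sum_(i <- r) l i.
Proof. by move=> fl; apply: cvg_big => //; exact: add_continuous. Qed.

Lemma cvg_prodr (I : Type) (r : seq I) (f : I -> T -> R) (l : I -> R) :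
  (forall i, f i x @[x --> F] --> l i) ->
  \prod_(i <- r) f i x @[x --> F] --> \prod_(i <- r) l i.
Proof. by move=> fl; apply: cvg_big => //; exact: mul_continuous. Qed.

Lemma cvg_mulmx m n p (f : T -> 'M[R]_(m, n)) (g : T -> 'M[R]_(n, p))
    (M : 'M[R]_(m, n)) (N : 'M[R]_(n, p)) :
  f x @[x --> F] --> M -> g x @[x --> F] --> N ->
  f x *m g x @[x --> F] --> M *m N.
Proof.
move=> /cvg_mxP fM /cvg_mxP gN; apply/cvg_mxP => i j.
under eq_cvg do rewrite mxE.
by rewrite mxE; apply: cvg_sumr => k; exact: cvgM.
Qed.

Lemma cvg_trmx m n (f : T -> 'M[R]_(m, n)) (M : 'M[R]_(m, n)) :
  f x @[x --> F] --> M -> (f x)^T @[x --> F] --> M^T.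
Proof.
move=> /cvg_mxP fM; apply/cvg_mxP => i j; under eq_cvg do rewrite mxE.
by rewrite mxE; exact: fM.
Qed.

Lemma cvg_det n (f : T -> 'M[R]_n) (M : 'M[R]_n) :
  f x @[x --> F] --> M -> \det (f x) @[x --> F] --> \det M.
Proof.
move=> /cvg_mxP fM; apply: cvg_sumr => s.
by apply: cvgM; [exact: cvg_cst|apply: cvg_prodr => i].
Qed.

(** The adjugate formula writes the inverse by determinants, which are polynomial in the entries and
    hence continuous. *)
Lemma cvg_invmx n (f : T -> 'M[R]_n) (M : 'M[R]_n) : M \in unitmx ->
  f x @[x --> F] --> M ->
  (\forall x \near F, f x \in unitmx) /\ invmx (f x) @[x --> F] --> invmx M.
Proof.
move=> uM fM; have dM := cvg_det fM; have uM0 := uM.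
rewrite unitmxE unitfE in uM0.
have fu : \forall x \near F, f x \in unitmx.
  near=> x; rewrite unitmxE unitfE; near: x.
  exact: (cvgr_neq0 _ dM).
(* [invmx] returns its argument on a singular matrix, so the adjugate formula is available only
   eventually along the filter. *)
split=> //; apply: (@cvg_trans _ ((\det (f x))^-1 *: \adj (f x) @[x --> F])).
  apply: near_eq_cvg; near=> x; rewrite /invmx (near fu x) //.
rewrite /invmx uM; apply: cvgZ; first exact: cvgV.
apply/cvg_mxP => i j; under eq_cvg do rewrite mxE.
rewrite mxE; apply: cvgM; first exact: cvg_cst.
apply: cvg_det; apply/cvg_mxP => a b; under eq_cvg do rewrite !mxE.
by rewrite !mxE; exact: (cvg_mxP _ _).1.
Unshelve. all: by end_near. Qed.

End cvg_mx.

(** * Derivatives of matrix-valued functions of a real variable *)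

Section is_derive1.
Context {R : realType}.

Lemma is_derive1P (V : normedModType R) (f : R -> V) (x : R) (df : V) :
  is_derive x 1 f df <->
  h^-1 *: (f (h + x) - f x) @[h --> 0^'] --> df.
Proof.
have E : (fun h => h^-1 *: (f (h + x) - f x)) =
         (fun h => h^-1 *: ((f \o shift x) (h *: 1) - f x)).
  by apply/funext => h /=; rewrite [h%:A]mulr1.
split=> [[dfx <-]|]; rewrite E // => fdf.
by apply: DeriveDef; [apply/cvg_ex; exists df|exact/cvg_lim].
Qed.

Lemma cvg_dnbhs0_shift (x : R) : h + x @[h --> 0^'] --> x.
Proof.
rewrite -[X in _ --> X]add0r; apply: cvgD; last exact: cvg_cst.
exact: cvg_within.
Qed.

Lemma is_derive1_continuous (V : normedModType R) (f : R -> V) (x : R)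
    (df : V) :
  is_derive x 1 f df -> {for x, continuous f}.
Proof.
by move=> [dfx _]; apply/differentiable_continuous/derivable1_diffP.
Qed.

Lemma is_derive1_mulmx m n p (f : R -> 'M[R]_(m, n)) (g : R -> 'M[R]_(n, p))
    (x : R) (df : 'M[R]_(m, n)) (dg : 'M[R]_(n, p)) :
  is_derive x 1 f df -> is_derive x 1 g dg ->
  is_derive x 1 (fun t => f t *m g t) (df *m g x + f x *m dg).
Proof.
move=> fdf gdg; have gx := is_derive1_continuous gdg.
move: fdf gdg => /is_derive1P fdf /is_derive1P gdg; apply/is_derive1P.
(* The increment is split with [g] at the shifted point, whence the use of the continuity of [g]. *)
rewrite (_ : (fun h => _) = fun h => (h^-1 *: (f (h + x) - f x)) *m g (h + x) +
  f x *m (h^-1 *: (g (h + x) - g x))); last first.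
  apply/funext => h; rewrite -scalemxAl -scalemxAr -scalerDr.
  by rewrite mulmxBl mulmxBr addrA subrK.
apply: cvgD; apply: cvg_mulmx => //; last exact: cvg_cst.
by apply: (cvg_comp _ _ (@cvg_dnbhs0_shift x)).
Qed.

Lemma is_derive1_trmx m n (f : R -> 'M[R]_(m, n)) (x : R)
    (df : 'M[R]_(m, n)) :
  is_derive x 1 f df -> is_derive x 1 (fun t => (f t)^T) df^T.
Proof.
move=> /is_derive1P fdf; apply/is_derive1P.
under eq_cvg do rewrite -linearB -linearZ.
exact: cvg_trmx.
Qed.

Lemma is_derive1_mxsub m n m' n' (r : 'I_m' -> 'I_m) (c : 'I_n' -> 'I_n)
    (f : R -> 'M[R]_(m, n)) (x : R)
    (df : 'M[R]_(m, n)) :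
  is_derive x 1 f df ->
  is_derive x 1 (fun t => mxsub r c (f t)) (mxsub r c df).
Proof.
move=> /is_derive1P/cvg_mxP fdf; apply/is_derive1P/cvg_mxP => i j.
rewrite mxE; under eq_cvg do rewrite !mxE.
by have := fdf (r i) (c j); under eq_cvg do rewrite !mxE.
Qed.

Lemma is_derive1_ulsubmx m1 m2 n1 n2 (f : R -> 'M[R]_(m1 + m2, n1 + n2))
    (x : R) (df : 'M[R]_(m1 + m2, n1 + n2)) :
  is_derive x 1 f df -> is_derive x 1 (fun t => ulsubmx (f t)) (ulsubmx df).
Proof.
move=> /(is_derive1_mxsub (lshift m2) (lshift n2)).
rewrite ulsubmxEsub; under [X in _ -> is_derive _ _ X _]eq_fun do
  rewrite ulsubmxEsub.
by [].
Qed.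

Lemma is_derive1_ursubmx m1 m2 n1 n2 (f : R -> 'M[R]_(m1 + m2, n1 + n2))
    (x : R) (df : 'M[R]_(m1 + m2, n1 + n2)) :
  is_derive x 1 f df -> is_derive x 1 (fun t => ursubmx (f t)) (ursubmx df).
Proof.
move=> /(is_derive1_mxsub (lshift m2) (@rshift n1 n2)).
rewrite ursubmxEsub; under [X in _ -> is_derive _ _ X _]eq_fun do
  rewrite ursubmxEsub.
by [].
Qed.

End is_derive1.

(** * Differentiating triangular factors of Gram matrices *)

(** An exact identity before any limit, meant for [c = h^-1]. [S] is the sum of a lower and an upper
    triangular matrix that overlap only on the diagonal, so the lower one can be read off from [S];
    there [1 + U i i] is the factor to divide by. *)
Lemma trigmx_gram_diff (F : fieldType) n (L L0 : 'M[F]_n) (c : F) :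
    is_trig_mx L -> is_trig_mx L0 -> L \in unitmx -> L0 \in unitmx ->
    let U := L0 *m invmx L in
    let S := (invmx L)^T *m (c *: (L^T *m L - L0^T *m L0)) *m invmx L0 in
    (forall i, 1 + U i i != 0) ->
  c *: (L - L0) =
    (\matrix_(i, j) (if (j < i)%N then S i j else
       if i == j then S i i / (1 + U i i) else 0)) *m L0.
Proof.
move=> tL tL0 uL uL0 U S U1.
pose E := c *: (L - L0) *m invmx L0.
have tU : is_trig_mx U by apply: trigmx_mulmx; rewrite ?trigmx_invmx.
have tE : is_trig_mx E.
  apply: trigmx_mulmx; last exact: trigmx_invmx.
  apply/is_trig_mxP => i j ij; rewrite !mxE.
  by rewrite (is_trig_mxP tL) // (is_trig_mxP tL0) // subrr mulr0.
(* This comes from [L^T L - L0^T L0 = L^T (L - L0) + (L - L0)^T L0]. *)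
have SE : S = E + (E *m U)^T.
  rewrite /S (_ : c *: _ = L^T *m (c *: (L - L0)) + (c *: (L - L0))^T *m L0).
    rewrite mulmxDr mulmxDl; congr (_ + _).
      by rewrite mulmxA -trmx_mul mulmxV // trmx1 mul1mx.
    rewrite -!mulmxA mulmxV // mulmx1 -trmx_mul; congr trmx.
    by rewrite /E /U mulKmx.
  rewrite [(c *: _)^T]linearZ /= -scalemxAl -scalemxAr -scalerDr.
  congr (_ *: _).
  by rewrite [(_ - _)^T]linearB /= mulmxBr mulmxBl addrA subrK.
rewrite -[LHS]mulmx1 -(mulVmx uL0) [LHS]mulmxA -/E; congr (_ *m _).
apply/matrixP => i j; rewrite [RHS]mxE.
have [ji|ij|/val_inj ->] := ltngtP j i.
- rewrite SE [RHS]mxE [X in _ = _ + X]mxE (trigmx_mulmxE tE tU) ?(ltnW ji) //.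
  by rewrite -val_eqE ltn_eqF // addr0.
- by rewrite -val_eqE /= ltn_eqF // (is_trig_mxP tE).
- have -> : S i i = E i i * (1 + U i i).
    rewrite SE [LHS]mxE [X in _ + X = _]mxE (trigmx_mulmxE tE tU) //.
    by rewrite eqxx mulrDr mulr1.
  by rewrite eqxx mulfK.
Qed.

Lemma is_derive1_gram_factor (R : realType) n (L G : R -> 'M[R]_n) (x : R)
    (dG : 'M[R]_n) :
    (\forall t \near x, is_trig_mx (L t)) -> {for x, continuous L} ->
    L x \in unitmx -> (\forall t \near x, (L t)^T *m L t = G t) ->
    is_derive x 1 G dG ->
    let S := (invmx (L x))^T *m dG *m invmx (L x) in
  is_derive x 1 L ((strict_lower_part S + 2^-1 *: diag_part S) *m L x).
Proof.
move=> tL cL uL LG /is_derive1P dGx S; apply/is_derive1P.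
have shx := @cvg_dnbhs0_shift R x.
have cLh : L (h + x) @[h --> 0^'] --> L x by exact: cvg_comp shx cL.
have [uLh cV] := cvg_invmx uL cLh.
pose U h := L x *m invmx (L (h + x)).
pose Sh h :=
  (invmx (L (h + x)))^T *m (h^-1 *: (G (h + x) - G x)) *m invmx (L x).
have cS : Sh h @[h --> 0^'] --> S.
  by apply: cvg_mulmx; [apply: cvg_mulmx => //; exact: cvg_trmx|exact: cvg_cst].
(* By continuity [U h] tends to the identity. The limit 2 makes the divisors eventually nonzero and
   is the source of the coefficient [2^-1]. *)
have cU i : 1 + U h i i @[h --> 0^'] --> (2 : R).
  rewrite -[2]/(1 + 1); apply: cvgD; first exact: cvg_cst.
  have : U h @[h --> 0^'] --> L x *m invmx (L x).
    by apply: cvg_mulmx => //; exact: cvg_cst.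
  by move/cvg_mxP => /(_ i i); rewrite mulmxV // mxE eqxx.
apply: (@cvg_trans _ ((\matrix_(i, j) (if (j < i)%N then Sh h i j else
       if i == j then Sh h i i / (1 + U h i i) else 0)) *m L x @[h --> 0^'])).
  apply: near_eq_cvg; near=> h; rewrite /Sh /U.
  have -> : G (h + x) = (L (h + x))^T *m L (h + x).
    by apply/esym; near: h; exact: (shx _ LG).
  have -> : G x = (L x)^T *m L x by apply/esym; exact: (nbhs_singleton LG).
  rewrite -trigmx_gram_diff //.
  - by near: h; exact: (shx _ tL).
  - exact: (nbhs_singleton tL).
  - by near: h.
  - near: h; apply: filter_forall => i.
    by have /cvgr_neq0 := cU i; apply; rewrite pnatr_eq0.
apply: cvg_mulmx; last exact: cvg_cst.
have cSij := (cvg_mxP _ _).1 cS; clearbody S.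
apply/cvg_mxP => i j; under eq_cvg do rewrite mxE.
rewrite !mxE -val_eqE /=.
case: ltngtP => [ji|ij|/val_inj ->].
- by rewrite mulr0 addr0; exact: cSij.
- by rewrite mulr0 addr0; exact: cvg_cst.
- rewrite add0r mulrC; apply: cvgM; first exact: cSij.
  by apply: cvgV; [rewrite pnatr_eq0|exact: cU].
Unshelve. all: by end_near. Qed.

(** Differentiability of [M] is a conclusion: its difference quotient equals [invmx (L (h + x))]
    applied to quotients of [B] and [L] that converge. *)
Lemma is_derive1_mulmx_solve (R : realType) m n (L : R -> 'M[R]_m)
    (M B : R -> 'M[R]_(m, n)) (x : R) (dL : 'M[R]_m) (dB : 'M[R]_(m, n)) :
    L x \in unitmx -> (\forall t \near x, L t *m M t = B t) ->
    is_derive x 1 L dL -> is_derive x 1 B dB ->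
  is_derive x 1 M (invmx (L x) *m (dB - dL *m M x)).
Proof.
move=> uL LM dLx /is_derive1P dBx; apply/is_derive1P.
have shx := @cvg_dnbhs0_shift R x.
have cLh : L (h + x) @[h --> 0^'] --> L x.
  exact: cvg_comp shx (is_derive1_continuous dLx).
have [uLh cV] := cvg_invmx uL cLh.
apply: (@cvg_trans _ (invmx (L (h + x)) *m (h^-1 *: (B (h + x) - B x) -
   (h^-1 *: (L (h + x) - L x)) *m M x) @[h --> 0^'])).
  apply: near_eq_cvg; near=> h.
  have -> : B (h + x) = L (h + x) *m M (h + x).
    by apply/esym; near: h; exact: (shx _ LM).
  have -> : B x = L x *m M x by apply/esym; exact: (nbhs_singleton LM).
  rewrite -scalemxAl -scalerBr mulmxBl opprB addrA subrK -mulmxBr scalemxAr.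
  by rewrite mulKmx //; near: h.
apply: cvg_mulmx => //; apply: cvgB => //.
by apply: cvg_mulmx; [exact/is_derive1P|exact: cvg_cst].
Unshelve. all: by end_near. Qed.

(** Transposition carries the strictly upper part of [M] below the diagonal, and the diagonal of
    [M^T + M] is doubled, which the factor [2^-1] undoes. *)
Lemma strict_lower_diag_sym (F : numFieldType) n (M : 'M[F]_n) :
  strict_lower_part (M^T + M) + 2^-1 *: diag_part (M^T + M) =
  (strict_upper_part M)^T + diag_part M + strict_lower_part M.
Proof.
apply/matrixP => i j; rewrite !mxE -!val_eqE /=.
case: ltngtP => [_|_|/val_inj ->]; rewrite ?mulr0 ?addr0 //.
by rewrite !add0r -mulr2n -[X in _ * X]mulr_natl mulKf // pnatr_eq0.
Qed.

(* MathComp-Analysis.  The derivative F^`() of a matrix-valued F is the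
   entrywise one (derive_mx), and is_trig_mx means lower triangular. *)
Theorem lemma1 (R : realType) (k s l : nat)
    (A : R -> 'M[R]_(k + s, s + l)) (Q : R -> 'M[R]_(k + s))
    (L12 : R -> 'M[R]_(k, l)) (L21 : R -> 'M[R]_s) (L22 : R -> 'M[R]_(s, l))
    (theta : R)
    (X : 'M[R]_(k, s)) (N : 'M[R]_(k, l)) (Y : 'M[R]_s) (V : 'M[R]_(s, l))
    (dA : derivable A theta 1)
    (orthQ : \forall t \near theta, orthogonal_mx (Q t))
    (QA : \forall t \near theta,
       Q t *m A t = block_mx 0 (L12 t) (L21 t) (L22 t))
    (trigL21 : \forall t \near theta, is_trig_mx (L21 t))
    (contL21 : {for theta, continuous L21})
    (unitL21 : L21 theta \in unitmx)
    (QdA : Q theta *m A^`()%classic theta = block_mx X N Y V) :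
  let YL := Y *m invmx (L21 theta) in
  let Lbar := strict_lower_part YL in
  let D := diag_part YL in
  let Ubar := strict_upper_part YL in
  [/\ derivable L21 theta 1,
      derivable L22 theta 1,
      L21^`()%classic theta = (Ubar^T + D + Lbar) *m L21 theta &
      L22^`()%classic theta =
        (Ubar^T - Ubar) *m L22 theta
        + (invmx (L21 theta))^T *m X^T *m L12 theta + V].
Proof.
move=> YL Lbar D Ubar.
set L := L21 theta; set M := L22 theta.
pose P := block_mx X N Y V.
pose B := block_mx 0 (L12 theta) L M.
have QtQ : (Q theta)^T *m Q theta = 1%:M by have [] := nbhs_singleton orthQ.
have QAt : Q theta *m A theta = B by exact: nbhs_singleton QA.
have isdA : is_derive theta 1 A (A^`()%classic theta).
  by rewrite derive1E; exact: derivableP.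
(* Since [Q theta] is orthogonal, it cancels from both products, and the derivative of [A^T A]
   depends only on [P] and [B]. *)
have gramE : (A^`()%classic theta)^T *m A theta +
    (A theta)^T *m A^`()%classic theta = P^T *m B + B^T *m P.
  rewrite -QAt /P -QdA !trmx_mul -!mulmxA.
  by rewrite ![_^T *m (Q theta *m _)]mulmxA QtQ !mul1mx.
have dgram := is_derive1_mulmx (is_derive1_trmx isdA) isdA.
rewrite gramE /P /B !tr_block_mx !mulmx_block trmx0 !mulmx0 !mul0mx !add0r
  add_block_mx in dgram.
have near_gram : \forall t \near theta, (A t)^T *m A t =
    block_mx ((L21 t)^T *m L21 t) ((L21 t)^T *m L22 t)
      ((L12 t)^T *m 0 + (L22 t)^T *m L21 t)
      ((L12 t)^T *m L12 t + (L22 t)^T *m L22 t).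
  near=> t.
  have QtQt : (Q t)^T *m Q t = 1%:M by have [] := near orthQ t.
  transitivity ((Q t *m A t)^T *m (Q t *m A t)).
    by rewrite trmx_mul -mulmxA [_^T *m (Q t *m _)]mulmxA QtQt mul1mx.
  by rewrite (near QA t) // tr_block_mx mulmx_block trmx0 !mul0mx !add0r.
have LL : \forall t \near theta, (L21 t)^T *m L21 t = ulsubmx ((A t)^T *m A t).
  by near=> t; rewrite (near near_gram t) // block_mxKul.
have LM : \forall t \near theta, (L21 t)^T *m L22 t = ursubmx ((A t)^T *m A t).
  by near=> t; rewrite (near near_gram t) // block_mxKur.
have := is_derive1_gram_factor trigL21 contL21 unitL21 LL
  (is_derive1_ulsubmx dgram).
have LV : L *m invmx L = 1%:M by exact: mulmxV.
rewrite block_mxKul -/L.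
have -> : (invmx L)^T *m (Y^T *m L + L^T *m Y) *m invmx L = YL^T + YL.
  rewrite mulmxDr mulmxDl /YL -/L trmx_mul -!mulmxA LV mulmx1; congr (_ + _).
  by rewrite mulmxA -trmx_mul LV trmx1 mul1mx.
rewrite /= strict_lower_diag_sym -/Lbar -/D -/Ubar => dL.
(* [L22] solves a linear system with matrix [L21^T], whose derivative is now known. *)
have := is_derive1_mulmx_solve _ LM (is_derive1_trmx dL)
  (is_derive1_ursubmx dgram).
rewrite unitmx_tr unitL21 => /(_ isT); rewrite block_mxKur -/L -/M => dM.
split.
- by case: dL.
- by case: dM.
- by rewrite derive1E; case: dL.
rewrite derive1E; case: dM => _ ->.
have YE : Y^T = L^T *m YL^T.
  by rewrite /YL -/L trmx_mul mulmxA -trmx_mul mulVmx // trmx1 mul1mx.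
(* Both transposes contain [Lbar^T + D] or its reverse counterpart: [YL^T] is [Lbar^T + D + Ubar^T]
   and the subtracted matrix is [Ubar + D + Lbar^T]. *)
have -> : Ubar^T - Ubar = YL^T - (Ubar^T + D + Lbar)^T.
  have DT : D^T = D.
    by apply/matrixP => i j; rewrite !mxE eq_sym; case: eqP => // ->.
  rewrite [in RHS](triangular_parts_sum YL) -/Lbar -/D -/Ubar.
  rewrite !linearD /= trmxK DT [Lbar^T + D]addrC [_ + Ubar^T]addrC.
  by rewrite -[- Ubar - D - _]addrA -opprD addrACA subrr addr0.
rewrite trmx_mul YE -!mulmxA.
(* [L^T] is factored out of every term but [X^T L12], which alone keeps the inverse transpose in the
   final formula. *)
rewrite (_ : _ - _ = X^T *m L12 theta +
    L^T *m ((YL^T - (Ubar^T + D + Lbar)^T) *m M + V)); last first.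
  rewrite mulmxDr mulmxBl mulmxBr -!addrA.
  by congr (_ + (_ + _)); rewrite addrC.
by rewrite [LHS]mulmxDr mulKmx ?unitmx_tr // trmx_inv addrCA addrA.
Unshelve. all: by end_near. Qed.
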